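(* Let $r\geq 2$ be an integer, let $G$ be a finite simple undirected $r$-regular graph, and let $\varphi$ be an edge labeling of $G$. Then $$|V_{int}(G,\varphi)|\leq\left\lfloor\frac{r\cdot|V(G)|-2\cdot\eta(G[V_{int}(G,\varphi)])}{2\cdot(r-1)}\right\rfloor.$$
   Context: An interval is a nonempty finite set of consecutive integers. An edge labeling of a graph $G$ is an injective function $\varphi:E(G)\to\{1,2,\dots,|E(G)|\}$ (equivalently a bijection). For a vertex $x$, its spectrum is $S_G(x,\varphi)=\{\varphi(e): e\in E(G),\ e \text{ incident with } x\}$, and $V_{int}(G,\varphi)=\{x\in V(G): S_G(x,\varphi)\text{ is an interval}\}$. For $V_0\subseteq V(G)$, $G[V_0]$ is the subgraph induced by $V_0$. For a graph $H$, $\eta(H)=0$ if $H$ has no vertices, and otherwise $\eta(H)$ is the number of connected components of $H$. *)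

(* Defs.v *)
From HB Require Import structures.
From mathcomp Require Import all_boot all_order all_algebra.

Set Implicit Arguments.
Unset Strict Implicit.
Unset Printing Implicit Defensive.

Record sgraph := SGraph {
  vertex :> finType;
  adj : rel vertex;
  adj_sym : symmetric adj;
  adj_irr : irreflexive adj }.

Definition edges (G : sgraph) : {set {set G}} :=
  [set [set p.1; p.2] | p : G * G & adj p.1 p.2].

Definition regular (G : sgraph) (r : nat) : Prop :=
  forall x : G, #|[set y | adj x y]| = r.

(* The values of phi outside [edges G] are irrelevant. *)
Definition edge_labeling (G : sgraph) (phi : {set G} -> nat) : Prop :=
  {in edges G &, injective phi} /\
  {in edges G, forall f, 0 < phi f <= #|edges G|}.

(* The spectrum is a finite set of integers, represented by a list which is
   only ever used through membership. *)
Definition spectrum (G : sgraph) (phi : {set G} -> nat) (x : G) : seq nat :=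
  [seq phi f | f in [set f in edges G | x \in f]].

(* Decidable form of: some a <= b satisfy s = {a, a+1, ..., b}; the endpoints
   are looked for in s itself. See [is_intervalP]. *)
Definition is_interval (s : seq nat) : bool :=
  has (fun a => has (fun b =>
    [&& a <= b, all [in index_iota a b.+1] s & all [in s] (index_iota a b.+1)])
  s) s.

Lemma is_intervalP (s : seq nat) :
  reflect (exists a b, a <= b /\ forall k, (k \in s) = (a <= k <= b))
          (is_interval s).
Proof.
apply: (iffP hasP) => [[a as_ /hasP[b bs /and3P[ab /allP s1 /allP s2]]]|].
  exists a, b; split=> // k; apply/idP/idP => [/s1|kab].
    by rewrite /= mem_index_iota ltnS.
  by apply: s2; rewrite mem_index_iota ltnS.
case=> a [b [ab sE]]; exists a; first by rewrite sE leqnn ab.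
apply/hasP; exists b; first by rewrite sE leqnn ab.
by rewrite ab /=; apply/andP; split; apply/allP => k;
  rewrite /= mem_index_iota ltnS sE.
Qed.

Definition Vint (G : sgraph) (phi : {set G} -> nat) : {set G} :=
  [set x | is_interval (spectrum phi x)].

Definition induced_adj (G : sgraph) (V0 : {set G}) : rel {x : G | x \in V0} :=
  fun u v => adj (val u) (val v).

Fact induced_sym (G : sgraph) (V0 : {set G}) : symmetric (@induced_adj G V0).
Proof. by move=> u v; apply: adj_sym. Qed.

Fact induced_irr (G : sgraph) (V0 : {set G}) : irreflexive (@induced_adj G V0).
Proof. by move=> u; apply: adj_irr. Qed.

Definition induced (G : sgraph) (V0 : {set G}) : sgraph :=
  SGraph (@induced_sym G V0) (@induced_irr G V0).

Definition num_components (H : sgraph) : nat := n_comp (@adj H) H.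

Lemma num_components_no_vertices (H : sgraph) : #|H| = 0 -> num_components H = 0.
Proof.
move=> H0; apply/eqP; rewrite -leqn0 -H0; apply: subset_leq_card.
by apply/subsetP => x _.
Qed.

Lemma spectrumP (G : sgraph) (phi : {set G} -> nat) (x : G) (k : nat) :
  reflect (exists2 f, f \in edges G /\ x \in f & k = phi f)
          (k \in spectrum phi x).
Proof.
by apply: (iffP imageP) => -[f]; [rewrite inE => /andP[]|case] => fE xf ->;
  exists f => //; rewrite inE fE.
Qed.

(* Main.v *)
Require Import Defs.
From HB Require Import structures.
From mathcomp Require Import all_boot all_order all_algebra.
From mathcomp Require Import lra.
Set Implicit Arguments.
Unset Strict Implicit.
Unset Printing Implicit Defensive.
Import Order.TTheory GRing.Theory Num.Theory.
Local Open Scope ring_scope.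

(** For an interval vertex [x], let [L x] be the [r - 1] edges at [x] other than
    the one with the largest label. These sets are pairwise disjoint: if
    [f] lies in [L x] and in [L y], then the edge labelled [phi f + 1] is also
    incident with both [x] and [y], hence equal to [f]. Moreover, in each
    component of the subgraph induced by the interval vertices, a vertex whose
    largest label is maximal contributes one more edge, which belongs to no
    [L y]; these extra edges differ from one component to another. Therefore
    [(r - 1) |Vint| + eta <= |E| = r |V| / 2]. *)

Definition incident (G : sgraph) (x : G) : {set {set G}} :=
  [set f in edges G | x \in f].

Lemma edgesP (G : sgraph) (f : {set G}) :
  reflect (exists x y, adj x y /\ f = [set x; y]) (f \in edges G).
Proof.
apply: (iffP imsetP) => [[[x y]]|[x [y [xy ->]]]].
  by rewrite inE /= => xy ->; exists x, y.
by exists (x, y); rewrite ?inE.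
Qed.

Lemma card_edge (G : sgraph) (f : {set G}) : f \in edges G -> #|f| = 2.
Proof.
move=> /edgesP[x [y [xy ->]]]; rewrite cards2.
by case: eqP xy => [->|//]; rewrite adj_irr.
Qed.

Lemma incident_pair (G : sgraph) (x y : G) (f : {set G}) :
  x != y -> f \in incident x -> f \in incident y -> f = [set x; y].
Proof.
move=> xy; rewrite !inE => /andP[fE xf] /andP[_ yf]; apply/esym/eqP.
by rewrite eqEcard subUset !sub1set xf yf (card_edge fE) cards2 xy.
Qed.

Lemma incident_adj (G : sgraph) (x y : G) (f : {set G}) :
  x != y -> f \in incident x -> f \in incident y -> adj x y.
Proof.
move=> xy fx fy; move: (incident_pair xy fx fy) (fx).
rewrite inE => fxy /andP[/edgesP[u [v [uv fuv]]] _].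
have: x \in [set u; v] by rewrite -fuv fxy set21.
have: y \in [set u; v] by rewrite -fuv fxy set22.
rewrite !inE => /orP[]/eqP yE /orP[]/eqP xE; subst; rewrite ?eqxx // in xy *.
by rewrite adj_sym.
Qed.

Lemma card_incident (G : sgraph) (x : G) :
  #|incident x| = #|[set y | adj x y]|.
Proof.
have -> : incident x = [set [set x; y] | y in [set y | adj x y]].
  apply/setP=> f; apply/idP/imsetP => [fx|[y]]; last first.
    rewrite inE => xy ->; rewrite inE set21 andbT.
    by apply/edgesP; exists x, y.
  move: (fx); rewrite inE => /andP[/edgesP[u [v [uv ->]]]].
  rewrite !inE => /orP[]/eqP->; [exists v|exists u]; rewrite ?inE //.
    by rewrite adj_sym.
  by rewrite setUC.
apply: card_in_imset => y z; rewrite !inE => xy xz eq_yz.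
have: y \in [set x; z] by rewrite -eq_yz set22.
by rewrite !inE => /orP[/eqP yx|/eqP //]; rewrite yx adj_irr in xy.
Qed.

(** Double counting of the incident pairs (vertex, edge): each vertex lies on [r] edges, each edge
    has two ends. *)
Lemma handshake (G : sgraph) (r : nat) :
  regular G r -> (r * #|G| = 2 * #|edges G|)%N.
Proof.
move=> hG; transitivity (\sum_(x : G) #|incident x|)%N.
  under eq_bigr do rewrite card_incident hG.
  by rewrite sum_nat_const mulnC cardT.
transitivity (\sum_(x : G) \sum_(f in edges G | x \in f) 1)%N.
  by apply: eq_bigr => x _; rewrite sum1dep_card; apply: eq_card => f; rewrite !inE.
rewrite (exchange_big_dep (mem (edges G))) /= => [|x f _ /andP[]//].
rewrite mulnC -sum_nat_const; apply: eq_bigr => f fE.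
rewrite sum1dep_card -[RHS](card_edge fE).
by apply: eq_card => x; rewrite !inE fE.
Qed.

(** Positivity of [r] makes every [incident x] nonempty, so a maximum exists; finite choice then
    gathers the maximal edges into one function. *)
Lemma exists_top_edge (G : sgraph) (phi : {set G} -> nat) (r : nat) :
  (0 < r)%N -> regular G r ->
  exists t : G -> {set G}, forall x, t x \in incident x /\
    {in incident x, forall f, (phi f <= phi (t x))%N}.
Proof.
move=> r_gt0 hG; apply: (@fin_all_exists _ _ (fun x f => f \in incident x /\
  {in incident x, forall g, (phi g <= phi f)%N})) => x.
have /card_gt0P[f0 f0x] : (0 < #|incident x|)%N by rewrite card_incident hG.
by case: (arg_maxnP phi f0x) => f fx max_f; exists f.
Qed.

Section Packing.

Variables (G : sgraph) (phi : {set G} -> nat) (t : G -> {set G}).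
Hypothesis phi_inj : {in edges G &, injective phi}.
Hypothesis t_inc : forall x, t x \in incident x.
Hypothesis t_max : forall x, {in incident x, forall f, (phi f <= phi (t x))%N}.

Let L x := incident x :\ t x.

Let inc_edge x f : f \in incident x -> f \in edges G.
Proof. by rewrite inE => /andP[]. Qed.

Lemma lower_edge_lt x f : f \in L x -> (phi f < phi (t x))%N.
Proof.
rewrite in_setD1 => /andP[ft fx]; rewrite ltn_neqAle t_max // andbT.
apply: contra ft => /eqP eq_phi; apply/eqP.
by apply: phi_inj => //; [apply: inc_edge fx|apply: inc_edge (t_inc x)].
Qed.

(** The label of [f] is strictly below that of [t x], and both lie in the spectrum of [x]; an
    interval cannot skip the integer just after [phi f]. *)
Lemma lower_edge_succ x f : x \in Vint phi -> f \in L x ->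
  exists2 g, g \in incident x & phi g = (phi f).+1.
Proof.
rewrite inE => /is_intervalP[a [b [_ sE]]] fL; have f_lt := lower_edge_lt fL.
have fx : f \in incident x by case/setD1P: fL.
have spec g : g \in incident x -> (a <= phi g <= b)%N.
  by rewrite inE => /andP[gE xg]; rewrite -sE; apply/spectrumP; exists g.
have /andP[af _] := spec _ fx; have /andP[_ tb] := spec _ (t_inc x).
have: (phi f).+1 \in spectrum phi x.
  by rewrite sE (leq_trans af (leqnSn _)) (leq_trans f_lt tb).
by case/spectrumP => g [gE xg] ->; exists g; rewrite // inE gE.
Qed.

Lemma lower_edges_disjoint x y f : x \in Vint phi -> y \in Vint phi ->
  f \in L x -> f \in L y -> x = y.
Proof.
move=> xV yV fx fy; apply/eqP; apply: contraT => xy.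
have [g gx gE] := lower_edge_succ xV fx.
have [h hy hE] := lower_edge_succ yV fy.
have gh : g = h.
  by apply: phi_inj (inc_edge gx) (inc_edge hy) _; rewrite gE hE.
(* Both edges join the distinct vertices [x] and [y], and the graph is simple. Then [phi f] would be
   its own successor. *)
have fg : f = g.
  move: fx fy => /setD1P[_ fx] /setD1P[_ fy].
  by rewrite (incident_pair xy fx fy) (incident_pair xy gx) // gh.
by move: gE; rewrite fg => /n_Sn.
Qed.

Let H := induced (Vint phi).

Let H_sym : connect_sym (@adj H).
Proof. exact/sym_connect_sym/adj_sym. Qed.

Lemma shared_edge_connect (u v : H) f :
  f \in incident (val u) -> f \in incident (val v) -> connect (@adj H) u v.
Proof.
move=> fu fv; have [->|uv] := eqVneq u v; first exact: connect0.
exact/connect1/(@incident_adj G _ _ f).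
Qed.

Let top (z : H) : H := [arg max_(u > z | connect (@adj H) z u) phi (t (val u))].

Let topP z : connect (@adj H) z (top z) /\
  forall u, connect (@adj H) z u -> (phi (t (val u)) <= phi (t (val (top z))))%N.
Proof. by rewrite /top; case: arg_maxnP; first exact: connect0. Qed.

(** An edge shared by [top z] and [top w] makes these vertices equal or adjacent, so [z] and [w] lie
    in one component and, being roots, coincide. *)
Lemma card_top_edges :
  #|[set t (val (top z)) | z in roots (@adj H)]| = num_components H.
Proof.
rewrite card_in_imset => [|z w /eqP zr /eqP wr eq_t].
  by apply: eq_card => z; rewrite !inE andbT.
have [[z_top _] [w_top _]] := (topP z, topP w).
rewrite -zr -wr; apply/(fingraph.rootP H_sym).
apply: connect_trans z_top _; rewrite H_sym; apply: connect_trans w_top _.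
by apply: (@shared_edge_connect _ _ (t (val (top w)))); rewrite // -eq_t.
Qed.

(** Such a [y] would be an end of the edge, hence in the component of [z], with a top label
    exceeding the maximum over that component. *)
Lemma top_edge_not_lower z y : y \in Vint phi -> t (val (top z)) \notin L y.
Proof.
move=> yV; apply/negP => tL; have lt_t := lower_edge_lt tL.
have [z_top z_max] := topP z; have ty : t (val (top z)) \in incident y.
  by case/setD1P: tL.
have: connect (@adj H) z (Sub y yV : H).
  apply: connect_trans z_top _.
  by apply: (@shared_edge_connect _ _ (t (val (top z)))); rewrite ?SubK.
by move/z_max; rewrite SubK leqNgt lt_t.
Qed.

Lemma packing_bound r : regular G r ->
  (#|Vint phi| * r.-1 + num_components H <= #|edges G|)%N.
Proof.
move=> hG; rewrite -card_top_edges.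
set T := [set _ | z in _]; set U := \bigcup_(x in Vint phi) L x.
have cardU : #|U| = (#|Vint phi| * r.-1)%N.
  (* The union now runs over all vertices, with the empty set outside [Vint phi]; disjointness is
     only at stake between two interval vertices. *)
  rewrite /U big_mkcond -sum1_card partition_disjoint_bigcup /=; last first.
    move=> x y; case: ifP => xV; case: ifP => yV; rewrite -?setI_eq0 ?set0I ?setI0 //.
    apply: contraNT => /set0Pn[f /setIP[fx fy]].
    by apply/eqP; apply: lower_edges_disjoint fx fy.
  rewrite -sum_nat_const [RHS]big_mkcond; apply: eq_bigr => x _.
  rewrite sum1_card; case: ifP => _; last exact: cards0.
  by rewrite -(hG x) -card_incident [#|incident x|](cardsD1 (t x)) t_inc.
have disUT : [disjoint U & T].
  apply/pred0P => f; apply/negP => /andP[/bigcupP[y yV fy] /imsetP[z _ fE]].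
  by move/negP: (@top_edge_not_lower z y yV); rewrite -fE.
rewrite -cardU -cardsUI (disjoint_setI0 disUT) cards0 addn0.
apply/subset_leq_card/subsetP => f /setUP[/bigcupP[x _ /setD1P[_]]|/imsetP[z _ ->]].
  exact: inc_edge.
exact: inc_edge (t_inc _).
Qed.

End Packing.

Theorem theorem2 (r : nat) (G : sgraph) (phi : {set G} -> nat)
    (hr : (2 <= r)%N) (hG : regular G r) (hphi : edge_labeling phi) :
  (#|Vint phi|)%:Z <=
    Num.floor ((r%:R * #|G|%:R - 2 * (num_components (induced (Vint phi)))%:R)
                 / (2 * (r%:R - 1)) : rat).
Proof.
have [phi_inj _] := hphi.
have [t tP] := exists_top_edge phi (ltnW hr) hG.
have bound := packing_bound phi_inj (fun x => (tP x).1) (fun x => (tP x).2) hG.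
rewrite Num.Theory.floor_ge_int -natrM (handshake hG).
(* Writing the degree as [r.+1] turns both [r.-1] and the rational [r%:R - 1] of the denominator
   into the new, positive [r]. *)
case: r hr hG bound => // r; rewrite ltnS => r_gt0 _ /=.
rewrite -(ler_nat rat) natrD !natrM => bound.
have r_pos : 0 < r%:R :> rat by rewrite ltr0n.
rewrite -[r.+1%:R]natr1 addrK ler_pdivlMr ?mulr_gt0 //.
rewrite -pmulrn; lra.
Qed.
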